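(* Let $n\in\mathbb{N}$, $H=H^\top\in\mathbb{R}^{2n\times2n}$, $\mathcal H(x)=\frac12x^\top Hx$, and $\Phi^{\Delta T}(x)=M(\Delta T)x$ with \[ M(\Delta T):=e^{\Delta T J_{2n}H}=\begin{pmatrix}A(\Delta T)&B(\Delta T)\\C(\Delta T)&D(\Delta T)\end{pmatrix} \] ($n\times n$ blocks). Let $\mathcal R:=\{\Delta T\in\mathbb{R}:\det D(\Delta T)=0\}$. Then $\mathcal R$ is discrete (has no finite accumulation point). Moreover, for any $\Delta T\notin\mathcal R$ with $\Delta T\neq0$: the map $\boldsymbol\Psi(q,p):=(q,C(\Delta T)q+D(\Delta T)p)$ is a diffeomorphism of $\mathbb{R}^{2n}$ onto $\mathbb{R}^{2n}$, $D(\Delta T)$ is invertible, and there exists $S\in C^1(\mathbb{R}^{2n})$, unique up to an additive constant, such that, with $(q,\mathbf p(q,P)):=\boldsymbol\Psi^{-1}(q,P)$ and $\mathbf Q(q,P):=A(\Delta T)q+B(\Delta T)\mathbf p(q,P)$, \[ \mathbf p(q,P)=\partial_qS(q,P),\qquad \mathbf Q(q,P)=\partial_PS(q,P)\quad\text{for all }(q,P)\in\mathbb{R}^{2n}, \] and $S^{\Delta T}(q,P):=\frac1{\Delta T}(S(q,P)-q^\top P)$ satisfies $J_{2n}^\top\frac{\Phi^{\Delta T}(x)-x}{\Delta T}=\nabla_{(q,P)}S^{\Delta T}(I_1x+I_2\Phi^{\Delta T}(x))$ for all $x\in\mathbb{R}^{2n}$.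
   Context: $J_{2n}=\begin{bmatrix}0_n&I_n\\-I_n&0_n\end{bmatrix}$, $I_1=\begin{bmatrix}I_n&0\\0&0\end{bmatrix}$, $I_2=\begin{bmatrix}0&0\\0&I_n\end{bmatrix}$; $x=(q,p)\in\mathbb{R}^n\times\mathbb{R}^n$. $\Phi^{\Delta T}$ is the time-$\Delta T$ flow of $\dot x=J_{2n}\nabla\mathcal H(x)=J_{2n}Hx$. *)

(* Defs.v *)
From HB Require Import structures.
From mathcomp Require Import all_boot all_order all_algebra.
From mathcomp Require Import all_classical all_reals all_analysis.
Set Implicit Arguments. Unset Strict Implicit. Unset Printing Implicit Defensive.
Import Order.TTheory GRing.Theory Num.Theory.
Import numFieldNormedType.Exports.
Local Open Scope ring_scope.
Local Open Scope classical_set_scope.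

Definition expmx {R : realType} {m : nat} (A : 'M[R]_m) : 'M[R]_m :=
  lim (series (fun k : nat => (k`!%:R)^-1 *: A ^+ k) @ \oo).

Definition Jmx {R : realType} (n : nat) : 'M[R]_(n + n) :=
  block_mx 0 1%:M (- 1%:M) 0.
Definition I1mx {R : realType} (n : nat) : 'M[R]_(n + n) :=
  block_mx 1%:M 0 0 0.
Definition I2mx {R : realType} (n : nat) : 'M[R]_(n + n) :=
  block_mx 0 0 0 1%:M.

Definition Mflow {R : realType} {n : nat} (H : 'M[R]_(n + n)) (t : R) :=
  expmx (t *: (Jmx n *m H)).
Definition Ablk {R : realType} {n : nat} (H : 'M[R]_(n + n)) t := ulsubmx (Mflow H t).
Definition Bblk {R : realType} {n : nat} (H : 'M[R]_(n + n)) t := ursubmx (Mflow H t).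
Definition Cblk {R : realType} {n : nat} (H : 'M[R]_(n + n)) t := dlsubmx (Mflow H t).
Definition Dblk {R : realType} {n : nat} (H : 'M[R]_(n + n)) t := drsubmx (Mflow H t).

Definition is_grad {R : realType} {m : nat} (f : 'cV[R]_m -> R^o)
    (x g : 'cV[R]_m) : Prop :=
  differentiable f x /\ forall h : 'cV[R]_m, 'd f x h = \sum_i g i 0 * h i 0.

Definition C1 {R : realType} {m : nat} (f : 'cV[R]_m -> R^o) : Prop :=
  exists G : 'cV[R]_m -> 'cV[R]_m, continuous G /\ forall x, is_grad f x (G x).

Fixpoint Ck {R : realType} {U V : normedModType R} (k : nat) (f : U -> V) : Prop :=
  match k with
  | 0 => continuous f
  | k'.+1 => (forall x, differentiable f x) /\ forall v : U, Ck k' (fun x => 'd f x v)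
  end.
Definition smooth {R : realType} {U V : normedModType R} (f : U -> V) :=
  forall k, Ck k f.

Definition diffeo {R : realType} {U : normedModType R} (f : U -> U) : Prop :=
  exists g : U -> U, cancel f g /\ cancel g f /\ smooth f /\ smooth g.

(* Main.v *)
(* The entries of exp(t J H), and hence det D(t), have derivatives growing at
   most geometrically in the order of derivation.  If zeros of such a function
   accumulate at t0, Rolle's theorem makes all its derivatives vanish at t0, so
   it vanishes identically; but det D(0) = 1.
   For the generating function: M = exp(t J H) is symplectic, because
   M^T J M has zero derivative.  Symplecticity makes the matrix of
   (q, P) |-> (p, Q) symmetric, so this linear map is the gradient of its
   quadratic form. *)
Require Import Defs.
From HB Require Import structures.
From mathcomp Require Import all_boot all_order all_algebra.
From mathcomp Require Import all_classical all_reals all_analysis.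
From mathcomp Require Import ring lra.
Import Order.TTheory GRing.Theory Num.Theory.
Import numFieldNormedType.Exports.
Local Open Scope ring_scope.

(** * Functions of one real variable with geometrically bounded derivatives *)

Lemma is_derive_continuous (R : realType) (f df : R -> R) :
  (forall x : R, is_derive x (1 : R) f (df x)) -> continuous f.
Proof.
move=> fP x; apply: differentiable_continuous; apply/derivable1_diffP.
by have [] := fP x.
Qed.

(** No order is imposed on [a] and [b], so that one estimate serves on both sides of a base
    point. *)
Lemma mvt_dist (R : realType) (f df : R -> R) (a b : R) :
  (forall x : R, is_derive x (1 : R) f (df x)) ->
  exists2 c, (Num.min a b <= c <= Num.max a b) & f b - f a = df c * (b - a).
Proof.
move=> fP; have fc := is_derive_continuous R f df fP.
have [ab|/ltW ba] := leP a b.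
  have [|c] := @MVT_segment R f df a b ab (fun x _ => fP x).
    exact: continuous_subspaceT.
  by rewrite in_itv/= => ? ?; exists c.
have [|c] := @MVT_segment R f df b a ba (fun x _ => fP x).
  exact: continuous_subspaceT.
rewrite in_itv/= => cab E; exists c => //.
by rewrite -opprB E -mulrN opprB.
Qed.

(* [F] lists the successive derivatives of [F 0]; a bound [C * K ^+ k] without a
   factorial is preserved by products, by Leibniz' rule. *)
Definition exp_type_seq {R : realType} (F : nat -> R -> R) : Prop :=
  (forall k (x : R), is_derive x (1 : R) (F k) (F k.+1 x)) /\
  forall T : R, exists C K : R, [/\ 0 <= C, 0 <= K &
    forall k x, `|x| <= T -> `|F k x| <= C * K ^+ k].

Definition exp_type {R : realType} (f : R -> R) : Prop :=
  exists2 F, F 0 = f & exp_type_seq F.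

Lemma exp_type_cst (R : realType) (a : R) : exp_type (fun=> a).
Proof.
exists (fun k => if k is 0 then fun=> a else fun=> 0) => //; split.
  by case=> [|k] x; exact: is_derive_cst.
move=> T; exists `|a|, 0; split=> // -[|k] x _; first by rewrite mulr1.
by rewrite normr0 exprS mul0r mulr0.
Qed.

Lemma exp_typeD (R : realType) (f g : R -> R) :
  exp_type f -> exp_type g -> exp_type (fun x => f x + g x).
Proof.
move=> [F <- [dF bF]] [G <- [dG bG]].
exists (fun k x => F k x + G k x) => //; split=> [k x|T].
  by apply: is_deriveD.
have [C [K [C0 K0 FP]]] := bF T; have [C' [K' [C'0 K'0 GP]]] := bG T.
exists (C + C'), (Num.max K K'); split; rewrite ?addr_ge0 ?le_max ?K0//.
move=> k x xT; rewrite (le_trans (ler_normD _ _))// mulrDl lerD//.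
  rewrite (le_trans (FP _ _ xT))// ler_wpM2l// lerXn2r ?nnegrE ?le_max ?K0//.
  by rewrite lexx.
rewrite (le_trans (GP _ _ xT))// ler_wpM2l// lerXn2r ?nnegrE ?le_max ?K0//.
by rewrite lexx orbT.
Qed.

Definition leibniz {R : realType} (F G : nat -> R -> R) (k : nat) (x : R) : R :=
  \sum_(i < k.+1) (F (k - i)%N x * G i x) *+ 'C(k, i).

(** Pascal's rule splits the coefficients; regrouped, the sum is the termwise derivative of
    [leibniz F G k]. *)
Lemma leibnizS (R : realType) (F G : nat -> R -> R) k x :
  leibniz F G k.+1 x =
  \sum_(i < k.+1) (F (k - i)%N x * G i.+1 x + F (k - i).+1 x * G i x) *+ 'C(k, i).
Proof.
rewrite /leibniz big_ord_recl/= subn0 bin0 mulr1n.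
under eq_bigr do rewrite subSS /bump/= add1n binS mulrnDr.
rewrite big_split/= [X in _ + (X + _)]big_ord_recr/=.
rewrite bin_small// mulr0n addr0.
under [RHS]eq_bigr do rewrite mulrnDl.
rewrite [RHS]big_split/= [RHS]addrC addrA; congr (_ + _).
rewrite [RHS]big_ord_recl/= subn0 bin0 mulr1n; congr (_ + _).
apply: eq_bigr => i _; rewrite /bump/= add1n; congr (F _ x * _ *+ _).
by rewrite subnSK.
Qed.

Lemma exp_typeM (R : realType) (f g : R -> R) :
  exp_type f -> exp_type g -> exp_type (fun x => f x * g x).
Proof.
move=> [F <- [dF bF]] [G <- [dG bG]].
exists (leibniz F G); first by apply/funext => x; rewrite /leibniz big_ord1.
split=> [k x|T].
  rewrite leibnizS.
  have -> : leibniz F G k =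
      \sum_(i < k.+1) ('C(k, i)%:R *: (F (k - i)%N * G i)).
    apply/funext => y; rewrite /leibniz fct_sumE; apply: eq_bigr => i _ /=.
    by rewrite -scaler_nat.
  apply: is_derive_sum => i.
  rewrite -[X in is_derive _ _ _ X]scaler_nat; apply: is_deriveZ.
  rewrite [X in _ + X]mulrC; exact: is_deriveM.
have [C [K [C0 K0 FP]]] := bF T; have [C' [K' [C'0 K'0 GP]]] := bG T.
exists (C * C'), (K + K'); split; rewrite ?mulr_ge0 ?addr_ge0//.
(* The binomial expansion of [(K + K') ^+ k] bounds the Leibniz sum term by term. *)
move=> k x xT; rewrite exprDn mulr_sumr (le_trans (ler_norm_sum _ _ _))//.
apply: ler_sum => i _; rewrite normrMn mulrnAr.
rewrite lerMn2r; apply/orP; right; rewrite normrM mulrACA.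
by apply: ler_pM => //; [exact: FP|exact: GP].
Qed.

Lemma exp_type_sum (R : realType) (I : Type) (r : seq I) (P : pred I)
    (f : I -> R -> R) :
  (forall i, exp_type (f i)) -> exp_type (fun x => \sum_(i <- r | P i) f i x).
Proof.
move=> fP; elim: r => [|i r ih].
  by under eq_fun do rewrite big_nil; exact: exp_type_cst.
under eq_fun do rewrite big_cons; case: (P i) => //.
exact: exp_typeD.
Qed.

Lemma exp_type_prod (R : realType) (I : Type) (r : seq I) (P : pred I)
    (f : I -> R -> R) :
  (forall i, exp_type (f i)) -> exp_type (fun x => \prod_(i <- r | P i) f i x).
Proof.
move=> fP; elim: r => [|i r ih].
  by under eq_fun do rewrite big_nil; exact: exp_type_cst.
under eq_fun do rewrite big_cons; case: (P i) => //.
exact: exp_typeM.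
Qed.

Lemma exp_type_det (R : realType) (n : nat) (M : R -> 'M[R]_n) :
  (forall i j, exp_type (fun x => M x i j)) -> exp_type (fun x => \det (M x)).
Proof.
move=> MP; rewrite /determinant; apply: exp_type_sum => s.
by apply: exp_typeM; [exact: exp_type_cst|exact: exp_type_prod].
Qed.

(** * Identity theorem and isolated zeros *)

Section identity_theorem.
Variables (R : realType) (F : nat -> R -> R).
Hypothesis FE : exp_type_seq F.
Let dF := FE.1.

(** Each use of the mean value theorem from [t] gains a factor [|x - t|] and raises the order of
    derivation by one, which costs a factor [K]. No factorial is gained, so the bound is useful only
    where [K * |x - t| < 1]. *)
Lemma zero_jet_bound (T C K t : R) : 0 <= C -> 0 <= K -> `|t| <= T ->
  (forall k x, `|x| <= T -> `|F k x| <= C * K ^+ k) ->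
  (forall k, F k t = 0) ->
  forall j k x, `|x| <= T -> `|F k x| <= C * K ^+ k * (K * `|x - t|) ^+ j.
Proof.
move=> C0 K0 tT FP F0; elim=> [|j ih] k x xT; first by rewrite mulr1 FP.
have [c /andP[c1 c2]] := mvt_dist R (F k) (F k.+1) t x (dF k).
rewrite F0 subr0 => ->; rewrite normrM.
have [cT ct] : `|c| <= T /\ `|c - t| <= `|x - t|.
  move: c1 c2 xT tT; rewrite !ler_norml ge_min le_max.
  have [xt|/ltW xt] := leP t x.
    rewrite [`|x - t|]ger0_norm ?subr_ge0//.
    move=> /orP[] ? /orP[] ? /andP[? ?] /andP[? ?]; split; lra.
  rewrite [`|x - t|]ler0_norm ?subr_le0//.
  by move=> /orP[] ? /orP[] ? /andP[? ?] /andP[? ?]; split; lra.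
rewrite (le_trans (ler_wpM2r _ (ih k.+1 c cT)))//.
rewrite [K ^+ k.+1]exprSr [(K * `|x - t|) ^+ _]exprSr.
rewrite [leRHS](_ : _ =
    C * (K ^+ k * K) * (K * `|x - t|) ^+ j * `|x - t|); last first.
  by rewrite !mulrA; ring.
rewrite ler_wpM2r// ler_wpM2l ?mulr_ge0 ?exprn_ge0//.
by rewrite lerXn2r ?nnegrE ?mulr_ge0// ler_wpM2l.
Qed.

Lemma zero_jet_nearby (T C K t : R) : 0 <= C -> 0 <= K -> `|t| <= T ->
  (forall k x, `|x| <= T -> `|F k x| <= C * K ^+ k) ->
  (forall k, F k t = 0) ->
  forall x, `|x| <= T -> K * `|x - t| < 1 -> forall k, F k x = 0.
Proof.
move=> C0 K0 tT FP F0 x xT Kx k; apply/eqP; rewrite -normr_le0.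
have FB := zero_jet_bound _ _ _ _ C0 K0 tT FP F0.
have q1 : `|K * `|x - t| | < 1 by rewrite ger0_norm// mulr_ge0.
(* The bound holds for every [j] and tends to 0 as [j] grows. *)
have /(cvgMl_tmp (a := C * K ^+ k)) := cvg_expr q1; rewrite mulr0.
move=> /cvgr_to_ge; apply; apply: nearW => j /=; exact: FB.
Qed.

Lemma zero_jet_everywhere (t : R) :
  (forall k, F k t = 0) -> forall k x, F k x = 0.
Proof.
move=> F0 k x; pose T := Num.max `|t| `|x|.
have [C [K [C0 K0 FP]]] := FE.2 T.
have tT : `|t| <= T by rewrite le_max lexx.
have xT : `|x| <= T by rewrite le_max lexx orbT.
(* The segment from [t] to [x] is cut into [N] equal steps, each short enough for [zero_jet_nearby].
   It lies within [|y| <= T], so the same [C] and [K] serve at every step. *)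
pose N := (Num.truncn (K * `|x - t|)).+1.
have NP : K * `|x - t| < N%:R by exact: truncnS_gt.
have N0 : 0 < N%:R :> R by rewrite ltr0n.
pose y (i : nat) : R := t + i%:R / N%:R * (x - t).
have yT i : (i <= N)%N -> `|y i| <= T.
  move=> iN; have a0 : 0 <= i%:R / N%:R :> R by rewrite divr_ge0.
  have a1 : 0 <= 1 - i%:R / N%:R :> R.
    by rewrite subr_ge0 ler_pdivrMr// mul1r ler_nat.
  rewrite (_ : y i = (1 - i%:R / N%:R) * t + i%:R / N%:R * x); last first.
    by rewrite /y; ring.
  rewrite (le_trans (ler_normD _ _))// [X in X + _]normrM [X in _ + X]normrM.
  rewrite (ger0_norm a0) (ger0_norm a1).
  have := ler_wpM2l a0 xT; have := ler_wpM2l a1 tT; lra.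
have yN : y N = x by rewrite /y divff ?lt0r_neq0// mul1r addrC subrK.
suff H i : (i <= N)%N -> forall k, F k (y i) = 0 by rewrite -yN H.
elim: i => [_|i ih iN] {}k; first by rewrite /y mul0r mul0r addr0.
apply: (@zero_jet_nearby T C K (y i)) => //.
- exact: yT (ltnW iN).
- by move=> ?; apply: ih; exact: ltnW.
- exact: yT.
rewrite (_ : y i.+1 - y i = (x - t) / N%:R); last first.
  by rewrite /y -[i.+1%:R]natr1; ring.
by rewrite normrM normfV (gtr0_norm N0) mulrA ltr_pdivrMr// mul1r.
Qed.

End identity_theorem.

(** Continuity gives [f t = 0]; Rolle's theorem between [t] and a nearby zero then gives a zero of
    [df] still closer to [t]. The conclusion reproduces the hypothesis for [df], so the lemma can be
    iterated. *)
Lemma accumulating_zeros_derive (R : realType) (f df : R -> R) (t : R) :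
  (forall x : R, is_derive x (1 : R) f (df x)) ->
  (forall e : R, 0 < e -> exists2 x, f x = 0 & 0 < `|x - t| < e) ->
  f t = 0 /\ forall e : R, 0 < e -> exists2 x, df x = 0 & 0 < `|x - t| < e.
Proof.
move=> fP fz; have fc := is_derive_continuous R f df fP.
have ft : f t = 0.
  apply/eqP/negP => /negP ft0.
  have /cvgrPdist_lt/(_ `|f t|) := fc t; rewrite normr_gt0 => /(_ ft0).
  move=> /nbhs_ballP[e /= e0 eP]; have [x fx /andP[_ xe]] := fz e e0.
  have := eP x; rewrite /ball/= distrC => /(_ xe).
  by rewrite fx subr0 ltxx.
split=> // e /fz[x fx /andP[xt xe]].
have [ab|ba|xt'] := ltgtP x t; last by rewrite xt' subrr normr0 ltxx in xt.
- have [|c] := @MVT R f df x t ab (fun x _ => fP x).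
    exact: continuous_subspaceT.
  rewrite in_itv/= ft fx subrr => /andP[c1 c2] /esym/eqP.
  rewrite mulf_eq0 subr_eq0 (gt_eqF ab) orbF => /eqP dfc.
  exists c => //; move: xe; rewrite !ltr0_norm ?subr_lt0// => xe.
  by apply/andP; split; lra.
- have [|c] := @MVT R f df t x ba (fun x _ => fP x).
    exact: continuous_subspaceT.
  rewrite in_itv/= ft fx subrr => /andP[c1 c2] /esym/eqP.
  rewrite mulf_eq0 subr_eq0 (gt_eqF ba) orbF => /eqP dfc.
  exists c => //; move: xe; rewrite !gtr0_norm ?subr_gt0// => xe.
  by apply/andP; split; lra.
Qed.

Lemma exp_type_isolated_zeros (R : realType) (f : R -> R) (a : R) :
  exp_type f -> f a != 0 -> forall t0 : R, exists2 e : R, 0 < e &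
    forall t : R, f t = 0 -> 0 < `|t - t0| -> e <= `|t - t0|.
Proof.
move=> [F <- FE] Fa t0; apply: contrapT => nP.
have [dF _] := FE.
suff /(zero_jet_everywhere R F FE) F0 : forall k, F k t0 = 0.
  by rewrite F0 eqxx in Fa.
suff H k : forall e : R, 0 < e -> exists2 x, F k x = 0 & 0 < `|x - t0| < e.
  move=> k.
  by have [] := accumulating_zeros_derive R (F k) (F k.+1) t0 (dF k) (H k).
elim: k => [|k ih].
  move=> e e0; apply: contrapT => nx; apply: nP; exists e => // t ft tt0.
  by rewrite leNgt; apply/negP => te; apply: nx; exists t; rewrite // tt0.
by have [] := accumulating_zeros_derive R (F k) (F k.+1) t0 (dF k) ih.
Qed.

(** * Entries of the matrix exponential as power series *)

Lemma cvg_mx_coord {R : numFieldType} (T : Type) (m n : nat) (F : set_system T)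
    {FF : Filter F} (M : T -> 'M[R]_(m, n)) (N : 'M[R]_(m, n)) :
  (forall i j, (fun x => M x i j) @ F --> N i j)%classic -> (M @ F --> N)%classic.
Proof.
move=> MN B [P NP PB].
have : (\forall x \near F,
    forall ij : 'I_m * 'I_n, P ij.1 ij.2 (M x ij.1 ij.2))%classic.
  by apply: filter_forall => -[i j] /=; exact: MN _ (NP i j).
by apply: filterS => x xP; apply: PB => i j; exact: (xP (i, j)).
Qed.

(** The sum of all absolute entries dominates every row sum, so each multiplication by [A] costs at
    most that factor. *)
Lemma norm_expr_mx_le (R : numDomainType) (m : nat) (A : 'M[R]_m) k i j :
  `|(A ^+ k) i j| <= (\sum_i \sum_j `|A i j|) ^+ k.
Proof.
elim: k i j => [|k ih] i j.
  by rewrite !expr0 mxE; case: eqP; rewrite ?normr1 ?normr0.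
rewrite !exprS mxE (le_trans (ler_norm_sum _ _ _))//.
rewrite (le_trans (_ : _ <= \sum_j `|A i j| * (\sum_i \sum_j `|A i j|) ^+ k))//.
  by apply: ler_sum => l _; rewrite normrM ler_wpM2l.
rewrite -mulr_suml ler_wpM2r ?exprn_ge0 ?sumr_ge0// => [l _|].
  by rewrite sumr_ge0.
by rewrite [leRHS](bigD1 i)//= lerDl sumr_ge0// => l _; rewrite sumr_ge0.
Qed.

(* The [p]-th derivative at [t] of the [(i, j)] entry of [expmx (t *: A)]. *)
Definition expmx_jet {R : realType} {m : nat} (A : 'M[R]_m) (i j : 'I_m)
    (p : nat) (t : R) : R :=
  limn (pseries (fun k => (A ^+ (p + k)) i j / k`!%:R) t).

Section expmx_jet.
Variables (R : realType) (m : nat) (A : 'M[R]_m).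
Let K : R := \sum_i \sum_j `|A i j|.
Let c i j p : R^nat := fun k => (A ^+ (p + k)) i j / k`!%:R.

Let K_ge0 : 0 <= K.
Proof. by rewrite /K sumr_ge0// => i _; rewrite sumr_ge0. Qed.

(** Majorant by [K ^+ p] times the exponential series at [K * |t|]: it yields both absolute
    convergence and the geometric growth in [p]. *)
Let norm_term_le i j p t k :
  `|c i j p k * t ^+ k| <= K ^+ p * exp_coeff (K * `|t|) k.
Proof.
rewrite /exp_coeff/= exprMn !normrM normfV normrX [`|k`!%:R|]ger0_norm//.
rewrite mulrAC [leRHS]mulrA mulrA -exprD.
rewrite ler_wpM2r ?invr_ge0// ler_wpM2r ?exprn_ge0//.
exact: norm_expr_mx_le.
Qed.

Let cvg_majorant p (t : R) :
  cvgn (series (fun k => K ^+ p * exp_coeff (K * `|t|) k)).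
Proof. exact/is_cvg_seriesZ/is_cvg_series_exp_coeff. Qed.

Let normed_cvg_jet i j p t :
  cvgn [normed series (fun k => c i j p k * t ^+ k)].
Proof.
apply: series_le_cvg (cvg_majorant p t) => [k|k|k] /=; [exact: normr_ge0| |];
  last exact: norm_term_le.
by rewrite mulr_ge0 ?exprn_ge0// exp_coeff_ge0// mulr_ge0.
Qed.

Lemma is_cvg_expmx_jet i j p t :
  cvgn (pseries (fun k => (A ^+ (p + k)) i j / k`!%:R) t).
Proof. exact: (normed_cvg (normed_cvg_jet i j p t)). Qed.

(** In termwise differentiation the factor [k.+1] cancels against the factorial, leaving the
    coefficients with one more power of [A]. *)
Lemma is_derive_expmx_jet i j p (t : R) :
  is_derive t (1 : R) (expmx_jet A i j p) (expmx_jet A i j p.+1 t).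
Proof.
have dc q : pseries_diffs (c i j q) = c i j q.+1.
  apply/funext => k; rewrite /pseries_diffs /c factS natrM addSnnS.
  by rewrite invfM mulrCA mulVKf.
rewrite /expmx_jet -/(c i j p) -/(c i j p.+1) -dc.
(* All these series converge everywhere; [|t| + 1] is just a point beyond [|t|]. *)
apply: (@pseries_snd_diffs _ _ (`|t| + 1)); rewrite ?dc.
- exact: is_cvg_expmx_jet.
- exact: is_cvg_expmx_jet.
- exact: is_cvg_expmx_jet.
- by rewrite [ltRHS]ger0_norm ?ltrDl// addr_ge0.
Qed.

Lemma norm_expmx_jet_le i j p t :
  `|expmx_jet A i j p t| <= expR (K * `|t|) * K ^+ p.
Proof.
rewrite mulrC -[leRHS](lim_seriesZ _ (is_cvg_series_exp_coeff _)).
apply: (le_trans (@lim_series_norm _ R^o _ (normed_cvg_jet i j p t))).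
exact: (lim_series_le (normed_cvg_jet i j p t) (cvg_majorant p t)
         (norm_term_le i j p t)).
Qed.

Lemma expmx_jet_seq i j : exp_type_seq (expmx_jet A i j).
Proof.
split=> [k x|T]; first exact: is_derive_expmx_jet.
exists (expR (K * T)), K; split=> // k x xT.
rewrite (le_trans (norm_expmx_jet_le _ _ _ _))// ler_wpM2r ?exprn_ge0//.
by rewrite ler_expR ler_wpM2l.
Qed.

Lemma expr_scalemx (t : R) k : (t *: A) ^+ k = t ^+ k *: A ^+ k.
Proof.
elim: k => [|k ih]; first by rewrite !expr0 scale1r.
by rewrite !exprS ih -[LHS]scalemxAl -scalemxAr scalerA.
Qed.

Lemma expmx_entry t i j : expmx (t *: A) i j = expmx_jet A i j 0 t.
Proof.
rewrite /expmx.
have -> : lim (series (fun k => (k`!%:R)^-1 *: (t *: A) ^+ k) @ \oo)%classic =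
    \matrix_(i, j) expmx_jet A i j 0 t; last by rewrite mxE.
apply/cvg_lim; first exact: norm_hausdorff.
apply: cvg_mx_coord => {}i {}j; rewrite mxE.
suff -> : (fun n => series (fun k => (k`!%:R)^-1 *: (t *: A) ^+ k) n i j) =
  pseries (fun k => (A ^+ (0 + k)) i j / k`!%:R) t by exact: is_cvg_expmx_jet.
apply/funext => n; rewrite /pseries /series/= summxE; apply: eq_bigr => k _.
by rewrite mxE expr_scalemx mxE; ring.
Qed.

(** Factoring one [A] out of each power turns the first derivative series into a finite combination
    of the series of order 0; this gives the differential equation of the exponential. *)
Lemma mul_expmx_entry t i j : (A *m expmx (t *: A)) i j = expmx_jet A i j 1 t.
Proof.
rewrite mxE; under eq_bigr do rewrite expmx_entry.
apply/esym/cvg_lim => //.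
have -> : pseries (fun k => (A ^+ (1 + k)) i j / k`!%:R) t =
  (fun n => \sum_l A i l * pseries (fun k => (A ^+ (0 + k)) l j / k`!%:R) t n).
  apply/funext => n; rewrite /pseries/series/=.
  under eq_bigr do rewrite exprS mxE !mulr_suml.
  rewrite exchange_big/=; apply: eq_bigr => l _.
  by rewrite mulr_sumr; apply: eq_bigr => k _; rewrite add0n !mulrA.
apply: cvg_big => [|l _]; first exact: add_continuous.
by apply: cvgMl_tmp; exact: is_cvg_expmx_jet.
Qed.

Lemma expmx0 : expmx (0 *: A) = 1%:M.
Proof.
rewrite /expmx; apply/cvg_lim; first exact: norm_hausdorff.
(* Partial sums are constant only from [n = 1] on: the empty sum lacks the identity term. *)
apply: cvg_near_cst; near=> n; rewrite -[n]prednK; last by near: n.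
rewrite /series/= big_nat_recl// fact0 invr1 scale1r expr0 big1 ?addr0// => k _.
by rewrite scale0r expr0n scaler0.
Unshelve. all: by end_near. Qed.

End expmx_jet.

(** * Matrix-valued derivatives and symplecticity of the flow *)

Definition is_derive_mx {R : realType} {m n : nat} (M : R -> 'M[R]_(m, n))
    (t : R) (N : 'M[R]_(m, n)) : Prop :=
  forall i j, is_derive t (1 : R) (fun s => M s i j) (N i j).

Lemma is_derive_mx_cst (R : realType) (m n : nat) (N : 'M[R]_(m, n)) (t : R) :
  is_derive_mx (fun=> N) t 0.
Proof. by move=> i j; rewrite mxE; exact: is_derive_cst. Qed.

Lemma is_derive_trmx (R : realType) (m n : nat) (M : R -> 'M[R]_(m, n)) t N :
  is_derive_mx M t N -> is_derive_mx (fun s => (M s)^T) t N^T.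
Proof.
move=> MN i j; rewrite mxE; under eq_fun do rewrite mxE; exact: MN.
Qed.

Lemma is_derive_mulmx (R : realType) (m n p : nat) (M : R -> 'M[R]_(m, n))
    (N : R -> 'M[R]_(n, p)) t M' N' :
  is_derive_mx M t M' -> is_derive_mx N t N' ->
  is_derive_mx (fun s => M s *m N s) t (M' *m N t + M t *m N').
Proof.
move=> dM dN i j; rewrite !mxE -big_split/=.
have -> : (fun s => (M s *m N s) i j) =
    \sum_(k < n) ((fun s => M s i k) * (fun s => N s k j)).
  by apply/funext => s; rewrite mxE fct_sumE.
apply: is_derive_sum => k; rewrite addrC [M' i k * _]mulrC.
exact: is_deriveM.
Qed.

Lemma is_derive_expmx (R : realType) (m : nat) (A : 'M[R]_m) (t : R) :
  is_derive_mx (fun s => expmx (s *: A)) t (A *m expmx (t *: A)).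
Proof.
move=> i j; rewrite mul_expmx_entry.
under eq_fun do rewrite expmx_entry.
exact: is_derive_expmx_jet.
Qed.

Lemma is_derive_mx0_cst (R : realType) (m n : nat) (M : R -> 'M[R]_(m, n)) s t :
  (forall x, is_derive_mx M x 0) -> M s = M t.
Proof.
move=> dM; apply/matrixP => i j.
apply: (@is_derive_0_is_cst _ (fun x => M x i j)) => x.
by have := dM x i j; rewrite mxE.
Qed.

Lemma Jmx_sqr (R : realType) (n : nat) : Jmx n *m Jmx n = - 1%:M :> 'M[R]_(n + n).
Proof.
rewrite mulmx_block !mul0mx !mul1mx !mulmx0 !mulmx1 !addr0 !add0r.
by rewrite scalar_mx_block opp_block_mx !oppr0.
Qed.

Lemma tr_Jmx (R : realType) (n : nat) : (Jmx n)^T = - Jmx n :> 'M[R]_(n + n).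
Proof.
by rewrite tr_block_mx opp_block_mx !trmx0 trmx1 linearN/= trmx1 !oppr0 opprK.
Qed.

Lemma Mflow_symplectic (R : realType) (n : nat) (H : 'M[R]_(n + n)) (t : R) :
  H^T = H -> (Mflow H t)^T *m Jmx n *m Mflow H t = Jmx n.
Proof.
move=> HT.
rewrite (is_derive_mx0_cst _ _ _
  (fun s => (Mflow H s)^T *m Jmx n *m Mflow H s) t 0).
  by rewrite /Mflow expmx0 trmx1 mul1mx mulmx1.
move=> x.
have dM := is_derive_expmx _ _ (Jmx n *m H) x.
have := is_derive_mulmx _ _ _ _ _ _ _ _ _ (is_derive_mulmx _ _ _ _ _ _ _ _ _
  (is_derive_trmx _ _ _ _ _ _ dM) (is_derive_mx_cst _ _ _ (Jmx n) x)) dM.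
(* The derivative is [M^T (H J^T J + J J H) M], which vanishes since [J^T J = 1] and [J J = -1]. *)
rewrite mulmx0 addr0 !trmx_mul HT tr_Jmx -!mulmxA.
rewrite mulNmx !(mulmxA (Jmx n) (Jmx n)) Jmx_sqr.
by rewrite !(mulNmx, mulmxN, mul1mx) opprK subrr.
Qed.

(** * Block identities and the Hessian of the generating function *)

Lemma symplectic_blocks (R : realType) (n : nat) (M : 'M[R]_(n + n)) :
  M^T *m Jmx n *m M = Jmx n ->
  let A := ulsubmx M in let B := ursubmx M in
  let C := dlsubmx M in let D := drsubmx M in
  [/\ A^T *m C = C^T *m A, B^T *m D = D^T *m B & D^T *m A - B^T *m C = 1%:M].
Proof.
rewrite -{1 2}(submxK M) tr_block_mx /Jmx !mulmx_block.
rewrite !(mulmx0, mulmx1, mulmxN, mulNmx, add0r, addr0).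
move=> /eq_block_mx[E1 _ E3 E4]; split.
- by apply/eqP; rewrite -subr_eq0 addrC E1.
- by apply/eqP; rewrite -subr_eq0 addrC E4.
- by apply: oppr_inj; rewrite -E3 opprB addrC.
Qed.

(* Hessian of the generating function: solving [P = C q + D p] for [p], the
   matrix of [(q, P) |-> (p, A q + B p)]. *)
Definition genfun_mx {R : realType} {n : nat} (M : 'M[R]_(n + n)) : 'M[R]_(n + n) :=
  let A := ulsubmx M in let B := ursubmx M in
  let C := dlsubmx M in let D := drsubmx M in
  block_mx (- (invmx D *m C)) (invmx D)
           (A - B *m invmx D *m C) (B *m invmx D).

(** [B D^-1] is symmetric because [B^T D] is. Then [D^T A - B^T C = 1] gives [A - B D^-1 C = D^-T],
    matching the off-diagonal blocks. Transposing this and multiplying by [C] gives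
    [D^-1 C = A^T C - C^T (B D^-1) C], a difference of symmetric matrices. *)
Lemma trmx_genfun_mx (R : realType) (n : nat) (M : 'M[R]_(n + n)) :
  M^T *m Jmx n *m M = Jmx n -> drsubmx M \in unitmx ->
  (genfun_mx M)^T = genfun_mx M.
Proof.
move=> /symplectic_blocks; rewrite /genfun_mx.
set A := ulsubmx M; set B := ursubmx M; set C := dlsubmx M; set D := drsubmx M.
move=> /= [AC BD DA] uD.
have uDT : D^T \in unitmx by rewrite unitmx_tr.
have BDs : (B *m invmx D)^T = B *m invmx D.
  rewrite trmx_mul trmx_inv; apply: (can_inj (mulKmx uDT)).
  by rewrite mulKVmx// mulmxA -BD mulmxK.
have AE : A - B *m invmx D *m C = (invmx D)^T.
  rewrite trmx_inv; apply: (can_inj (mulKmx uDT)); rewrite mulmxV// mulmxBr.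
  by rewrite !mulmxA -BD mulmxK.
have DCs : (invmx D *m C)^T = invmx D *m C.
  have -> : invmx D = A^T - C^T *m (B *m invmx D).
    by rewrite -[LHS]trmxK -AE linearB/= trmx_mul BDs.
  rewrite mulmxBl linearB/= trmx_mul trmxK.
  by rewrite !trmx_mul trmxK -trmx_mul BDs -AC !mulmxA.
by rewrite tr_block_mx AE trmxK BDs linearN/= DCs.
Qed.

Lemma genfun_mxE (R : realType) (n : nat) (M : 'M[R]_(n + n)) (q p : 'cV[R]_n) :
  drsubmx M \in unitmx ->
  genfun_mx M *m col_mx q (dlsubmx M *m q + drsubmx M *m p) =
  col_mx p (ulsubmx M *m q + ursubmx M *m p).
Proof.
move=> uD; rewrite mul_block_col; congr col_mx.
  by rewrite mulmxDr mulKmx// mulNmx mulmxA addrA addNr add0r.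
rewrite mulmxDr mulmxBl -!mulmxA mulKmx// addrA subrK//.
Qed.

(** * Smooth linear maps and gradients of quadratic forms *)

Lemma mulmx_continuous (R : realType) (m n : nat) (N : 'M[R]_(n, m)) :
  continuous (mulmx N : 'cV[R]_m -> 'cV[R]_n).
Proof.
move=> x; apply: (@cvg_mx_coord _ _ _ _ (nbhs x) _ (mulmx N)) => i j; rewrite mxE.
under eq_fun do rewrite mxE.
apply: cvg_big => [|k _]; first exact: add_continuous.
by apply: cvgMl_tmp; exact: coord_continuous.
Qed.

Lemma Ck_cst (R : realType) (U V : normedModType R) (k : nat) (a : V) :
  Ck k (fun _ : U => a).
Proof.
elim: k a => [|k ih] a /=; first exact: cst_continuous.
split=> [x|v]; first exact: differentiable_cst.
rewrite (_ : (fun x => _) = fun=> 0) //.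
by apply/funext => x; rewrite diff_cst.
Qed.

(** The differential is the same at every point, so beyond order 0 only constant maps remain. *)
Lemma smooth_linear (R : realType) (U V : normedModType R)
  (f : {linear U -> V}) : continuous f -> smooth f.
Proof.
move=> fc [|k] //=; split=> [x|v]; first exact: linear_differentiable.
rewrite (_ : (fun x => _) = fun=> f v); first exact: Ck_cst.
by apply/funext => x; rewrite diff_lin.
Qed.

Lemma diffeo_mulmx (R : realType) (m : nat) (N : 'M[R]_m) :
  N \in unitmx -> diffeo (mulmx N : 'cV[R]_m -> 'cV[R]_m).
Proof.
move=> uN; exists (mulmx (invmx N)); split; first exact: mulKmx.
split; first exact: mulKVmx.
by split; apply: smooth_linear; exact: mulmx_continuous.
Qed.

Lemma is_diff_sum (R : realType) (V W : normedModType R) (n : nat)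
    (f df : 'I_n -> V -> W) (x : V) :
  (forall i, is_diff x (f i) (df i)) ->
  is_diff x (\sum_(i < n) f i) (\sum_(i < n) df i).
Proof.
by elim/big_ind2 : _ => // [|] *; [exact: is_diff_cst|exact: is_diffD].
Qed.

Lemma is_diff_coord (R : realType) (m n : nat) (x : 'M[R]_(m, n)) i j :
  is_diff x (fun z : 'M[R]_(m, n) => z i j : R^o) (fun z => z i j).
Proof.
have lin : linear (fun z : 'M[R]_(m, n) => z i j : R^o).
  by move=> a u v; rewrite !mxE.
pose f : {linear 'M[R]_(m, n) -> R^o} :=
  HB.pack (fun z : 'M[R]_(m, n) => z i j : R^o)
    (GRing.isLinear.Build _ _ _ _ _ lin).
apply: DiffDef; first exact: differentiable_coord.
by rewrite -[fun z => _]/(f : _ -> _) diff_lin//; exact: coord_continuous.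
Qed.

Lemma is_grad_quadratic (R : realType) (m : nat) (G : 'M[R]_m) (x : 'cV[R]_m) :
  G^T = G -> is_grad (fun z => 2^-1 * (z^T *m G *m z) 0 0 : R^o) x (G *m x).
Proof.
move=> GT; pose c (i : 'I_m) (z : 'cV[R]_m) : R^o := z i 0.
have dc i : is_diff x (c i) (c i) by exact: is_diff_coord.
have -> : (fun z => 2^-1 * (z^T *m G *m z) 0 0 : R^o) =
    2^-1 *: \sum_j ((\sum_i G i j *: c i) * c j).
  apply/funext => z; rewrite mxE; congr (_ * _).
  rewrite fct_sumE; apply: eq_bigr => j _; rewrite mxE; congr (_ * _).
  by rewrite fct_sumE; apply: eq_bigr => i _; rewrite mxE mulrC.
have dS : is_diff x (2^-1 *: \sum_j ((\sum_i G i j *: c i) * c j))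
   (2^-1 *: \sum_j ((\sum_i G i j *: c i) x *: c j +
                     c j x *: (\sum_i G i j *: c i))).
  apply: is_diffZ; apply: is_diff_sum => j; apply: is_diffM.
  by apply: is_diff_sum => i; exact: is_diffZ.
split=> // h; rewrite diff_val.
rewrite -[LHS]/(2^-1 * _) fct_sumE.
have -> : \sum_(j < m) ((\sum_i G i j *: c i) x *: c j +
      c j x *: (\sum_i G i j *: c i)) h =
    2 * \sum_i (G *m x) i 0 * h i 0; last by rewrite mulKf.
(* The product rule gives two equal sums, which absorb the factor one half: the first needs the
   symmetry of [G], the second an exchange of summations. *)
rewrite big_split/= mulr_natl mulr2n; congr (_ + _).
  apply: eq_bigr => j _; congr (_ * _); rewrite fct_sumE mxE.
  by apply: eq_bigr => i _; rewrite -{1}GT mxE.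
transitivity (\sum_j \sum_i x j 0 * (G i j * h i 0)).
  by apply: eq_bigr => j _; rewrite -mulr_sumr; congr (_ * _); rewrite fct_sumE.
rewrite exchange_big/=; apply: eq_bigr => i _; rewrite mxE mulr_suml.
by apply: eq_bigr => j _; ring.
Qed.

Lemma is_grad_unique_cst (R : realType) (m : nat) (f g : 'cV[R]_m -> R^o)
    (G : 'cV[R]_m -> 'cV[R]_m) :
  (forall x, is_grad f x (G x)) -> (forall x, is_grad g x (G x)) ->
  exists c : R, forall z, g z = f z + c.
Proof.
move=> fG gG; exists (g 0 - f 0) => z.
suff E : g z - f z = g 0 - f 0 by rewrite -E addrC subrK.
(* Along the ray from 0 to [z] the difference has zero derivative, which reduces the claim to one
   variable. *)
pose k (t : R) : R^o := (g - f) (t *: z).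
suff : k 1 = k 0 by rewrite /k scale0r scale1r.
apply: is_derive_0_is_cst => t.
have dk : is_diff t k (cst 0).
  have dgf : is_diff (t *: z) (g - f) (cst 0).
    have [dg gE] := gG (t *: z); have [df fE] := fG (t *: z).
    apply: DiffDef; first exact: differentiableB.
    by rewrite diffB//; apply/funext => h /=; rewrite -[LHS]/(_ - _) gE fE subrr.
  exact: (is_diff_comp (is_diff_scalel _ _) dgf).
have dd : differentiable k t by [].
apply: DeriveDef; first exact/diff_derivable.
by rewrite deriveE// diff_val.
Qed.

(** * Resonance times and generating function of the linear Hamiltonian flow *)

Theorem theorem5 (R : realType) (n : nat) (H : 'M[R]_(n + n)) :
  H^T = H ->
  (* the resonance set {dT | det D(dT) = 0} has no finite accumulation point *)
  (forall t0 : R, exists2 e : R, 0 < e &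
     forall t : R, \det (Dblk H t) = 0 -> 0 < `|t - t0| -> e <= `|t - t0|) /\
  (forall dT : R, \det (Dblk H dT) != 0 -> dT != 0 ->
    let A := Ablk H dT in let B := Bblk H dT in
    let C := Cblk H dT in let D := Dblk H dT in
    let Phi := fun x : 'cV[R]_(n + n) => Mflow H dT *m x in
    let Psi := fun x : 'cV[R]_(n + n) =>
      col_mx (usubmx x) (C *m usubmx x + D *m dsubmx x) in
    (* condition: p = d_q S(q,P), Q = d_P S(q,P) where (q,p) = Psi^{-1}(q,P) *)
    let genfun := fun S : 'cV[R]_(n + n) -> R^o =>
      forall (q p P : 'cV[R]_n), Psi (col_mx q p) = col_mx q P ->
        is_grad S (col_mx q P) (col_mx p (A *m q + B *m p)) in
    diffeo Psi /\ D \in unitmx /\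
    (exists S : 'cV[R]_(n + n) -> R^o,
       C1 S /\ genfun S /\
       (forall S' : 'cV[R]_(n + n) -> R^o, C1 S' -> genfun S' ->
          exists c : R, forall z, S' z = S z + c) /\
       let SdT := fun z : 'cV[R]_(n + n) =>
         dT^-1 * (S z - ((usubmx z)^T *m dsubmx z) 0 0) : R^o in
       forall x : 'cV[R]_(n + n),
         is_grad SdT (I1mx n *m x + I2mx n *m Phi x)
                 ((Jmx n)^T *m (dT^-1 *: (Phi x - x))))).
Proof.
move=> HT; split.
  (* The point of nonvanishing is time 0, where [D] is the identity. *)
  apply: (exp_type_isolated_zeros _ (fun t => \det (Dblk H t)) 0).
    apply: exp_type_det => i j.
    exists (expmx_jet (Jmx n *m H) (rshift n i) (rshift n j));
      last exact: expmx_jet_seq.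
    by apply/funext => t; rewrite 2!mxE -expmx_entry.
  rewrite /Dblk /Mflow expmx0 scalar_mx_block block_mxKdr det1; exact: oner_neq0.
move=> dT detD dT0 A B C D Phi Psi genfun.
have uD : D \in unitmx by rewrite unitmxE unitfE.
have sG := trmx_genfun_mx _ _ _ (Mflow_symplectic _ _ H dT HT) uD.
set G := genfun_mx (Mflow H dT) in sG.
have PsiE : Psi = mulmx (block_mx 1%:M 0 C D).
  apply/funext => x; rewrite -[in RHS](vsubmxK x) mul_block_col.
  by rewrite mul1mx mul0mx addr0.
have GE (q p : 'cV[R]_n) :
    G *m col_mx q (C *m q + D *m p) = col_mx p (A *m q + B *m p).
  exact: genfun_mxE.
(* As [D] is invertible, every [z] is some [Psi (col_mx q p)]; hence [genfun] prescribes the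
   gradient [G *m z] everywhere, which settles existence and uniqueness together. *)
have gradE (S : 'cV[R]_(n + n) -> R^o) :
    genfun S <-> forall z, is_grad S z (G *m z).
  split=> [gS z|gS q p P]; last first.
    by rewrite /Psi col_mxKu col_mxKd => /eq_col_mx[_ <-]; rewrite -GE; exact: gS.
  pose p := invmx D *m (dsubmx z - C *m usubmx z).
  have pE : C *m usubmx z + D *m p = dsubmx z by rewrite mulKVmx// addrC subrK.
  rewrite -(vsubmxK z) -pE GE pE; apply: gS.
  by rewrite /Psi col_mxKu col_mxKd pE.
split.
  rewrite PsiE; apply: diffeo_mulmx.
  by rewrite unitmxE det_lblock det1 mul1r unitfE.
split=> //.
pose S (z : 'cV[R]_(n + n)) : R^o := 2^-1 * (z^T *m G *m z) 0 0.
have gS z : is_grad S z (G *m z) by exact: is_grad_quadratic.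
exists S; split; first by exists (mulmx G); split=> //; exact: mulmx_continuous.
split; first exact/gradE.
split=> [S' _ /gradE gS'|SdT x]; first exact: is_grad_unique_cst gS gS'.
(* [X] is the Hessian of [q^T P], so [SdT] is again a quadratic form, with symmetric matrix
   [dT^-1 *: (G - X)]. *)
pose X : 'M[R]_(n + n) := block_mx 0 1%:M 1%:M 0.
have XT : X^T = X by rewrite tr_block_mx !trmx0 !trmx1.
have -> : SdT = fun z => 2^-1 * (z^T *m (dT^-1 *: (G - X)) *m z) 0 0.
  apply/funext => z; rewrite /SdT /S -scalemxAr -scalemxAl mulmxBr mulmxBl.
  have -> (P Q : 'M[R]_1) : (dT^-1 *: (P - Q)) 0 0 = dT^-1 * (P 0 0 - Q 0 0).
    by rewrite !mxE.
  have -> : (z^T *m X *m z) 0 0 = 2 * ((usubmx z)^T *m dsubmx z) 0 0.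
    rewrite -{1 2}(vsubmxK z); move: (usubmx z) (dsubmx z) => u v.
    rewrite tr_col_mx mul_row_block mul_row_col.
    rewrite !(mulmx0, mulmx1, add0r, addr0) mxE mulr_natl mulr2n; congr (_ + _).
    by rewrite -[in RHS](trmxK v) -trmx_mul [RHS]mxE.
  by rewrite [RHS]mulrCA; congr (_ * _); rewrite mulrBr mulKf.
pose q := usubmx x; pose p := dsubmx x.
(* The evaluation point pairs the old position with the new momentum: it is [Psi x]. *)
have -> : I1mx n *m x + I2mx n *m Phi x = col_mx q (C *m q + D *m p).
  rewrite /Phi -(submxK (Mflow H dT)) -(vsubmxK x) !mul_block_col add_col_mx.
  by rewrite !(mul0mx, mul1mx, add0r, addr0).
suff -> : (Jmx n)^T *m (dT^-1 *: (Phi x - x)) =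
    (dT^-1 *: (G - X)) *m col_mx q (C *m q + D *m p).
  by apply: is_grad_quadratic; rewrite linearZ linearB/= sG XT.
(* With [Phi x = (Q, P)], both sides reduce to [(p - P, Q - q)]: [G] sends [(q, P)] to [(p, Q)] and
   [X] sends it to [(P, q)]. *)
rewrite -scalemxAr -scalemxAl; congr (_ *: _).
rewrite mulmxBl GE /Phi -{1}(submxK (Mflow H dT)) -(vsubmxK x).
rewrite !mul_block_col tr_block_mx !trmx0 trmx1 linearN/= trmx1.
rewrite !opp_col_mx !add_col_mx mul_block_col.
by rewrite !(mul0mx, mul1mx, add0r, addr0, mulNmx) opprB.
Qed.
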